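(* Consider the bi-objective problem $\min_{x\in S}f(x)$ with a data-set $\mathcal D$ of Pareto Front samples, and assume that the Pareto Front $\mathcal P$ is a continuous and compact curve in $\mathbb R^2$. Let $\bar h_{\mathcal D}(v)=\sup_{h\in FPFS_{\mathcal D}}h(v)$ and $\underline h_{\mathcal D}(v)=\inf_{h\in FPFS_{\mathcal D}}h(v)$ be the optimal bounds of the Feasible Pareto Function Set. Then for every $v\in[z_v^{*(a1)},z_v^{*(a2)}]$, $$\bar h_{\mathcal D}(v)=\min_{z^{*(j)}\in\{z^{*(j^-)}(v),\,z^{*(j^+)}(v)\}}\Big(z_q^{*(j)}+|v-z_v^{*(j)}|\Big),$$ $$\underline h_{\mathcal D}(v)=\max_{z^{*(j)}\in\{z^{*(j^-)}(v),\,z^{*(j^+)}(v)\}}\Big(z_q^{*(j)}-|v-z_v^{*(j)}|\Big).$$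
   Context: Setting. $f=(f_1,f_2):\mathbb R^n\to\mathbb R^2$, $S\subset\mathbb R^n$, $Z=\{f(x):x\in S\}$. Let $\mathbb R^2_{\succ0}$ (resp. $\mathbb R^2_{\prec0}$) be the set of nonzero vectors with non-negative (resp. non-positive) entries, and let $\oplus$ be the Minkowski sum. A point $z^{(1)}\in Z$ dominates $z^{(2)}\in Z$ iff $z^{(2)}\in\{z^{(1)}\}\oplus\mathbb R^2_{\succ0}$. The Pareto Front (PF) $\mathcal P$ is the set of all non-dominated points of $Z$. The anchor points $z^{*(a1)},z^{*(a2)}\in\mathcal P$ are the PF points minimizing $f_1$, resp. $f_2$, over $S$. Data. $\mathcal D=\{z^{*(a1)},z^{*(1)},\dots,z^{*(M-2)},z^{*(a2)}\}\subset\mathcal P$ is a finite set of $M\ge2$ PF points, including the anchor points, listed in strictly increasing order of the first coordinate. Transformation. $\delta_1,\delta_2>0$ are given tolerances, and $$W=\frac{\sqrt2}{2}\begin{bmatrix}1&-1\\1&1\end{bmatrix}\begin{bmatrix}1/\delta_1&0\\0&1/\delta_2\end{bmatrix}.$$ For a point $z\in\mathbb R^2$ write $[z_v,z_q]^T=Wz$. The samples are also strictly ordered by increasing $v$-coordinate. For a function $h:[z_v^{*(a1)},z_v^{*(a2)}]\to\mathbb R$ write $W^{-1}h=\{W^{-1}[v,h(v)]^T: v\in[z_v^{*(a1)},z_v^{*(a2)}]\}$. Under the assumption on $\mathcal P$, $\mathcal P=W^{-1}h$ for a continuous function $h$. Feasible set. For each $z^{*(j)}\in\mathcal D$ that is not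 an anchor point let $I^{(j)}=(\{z^{*(j)}\}\oplus\mathbb R^2_{\succ0})\cup(\{z^{*(j)}\}\oplus\mathbb R^2_{\prec0})$. For the anchor points, $I^{(a1)}$ is defined by the same formula (with $z^{*(a1)}$) together with the additional set $\{z:z_1<z_1^{*(a1)}\}$, and $I^{(a2)}$ by the same formula (with $z^{*(a2)}$) together with the additional set $\{z:z_2<z_2^{*(a2)}\}$. Let $\mathcal I_{\mathcal D}$ be the union of these sets over all points of $\mathcal D$, and $\mathcal A_{\mathcal D}=\mathbb R^2\setminus\mathcal I_{\mathcal D}$. The Feasible Pareto Function Set $FPFS_{\mathcal D}$ is the set of continuous functions $h:[z_v^{*(a1)},z_v^{*(a2)}]\to\mathbb R$ with $W^{-1}h\subset\mathcal A_{\mathcal D}$. Neighbouring samples. For $v\in[z_v^{*(a1)},z_v^{*(a2)}]$, $z^{*(j^-)}(v)$ is the element of $\mathcal D$ minimizing $|v-z_v^{*(j)}|$ subject to $z_v^{*(j)}\le v$, and $z^{*(j^+)}(v)$ is the element of $\mathcal D$ minimizing $|v-z_v^{*(j)}|$ subject to $z_v^{*(j)}\ge v$. *)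

(* Defs.v *)
From mathcomp Require Import all_boot all_order all_algebra.
From mathcomp Require Import all_classical all_reals all_analysis.

Set Implicit Arguments.
Unset Strict Implicit.
Unset Printing Implicit Defensive.

Import Order.TTheory GRing.Theory Num.Theory.
Import numFieldNormedType.Exports.

Local Open Scope classical_set_scope.
Local Open Scope ring_scope.

(* Points of the plane are column vectors: the first and second coordinates
   of z are z 0 0 and z 1 0. *)

Section Plane.
Variable R : realType.
Implicit Types (A B : set 'cV[R]_2) (y z : 'cV[R]_2).

Definition minkowski_sum A B : set 'cV[R]_2 := [set a + b | a in A & b in B].

Definition pos_cone : set 'cV[R]_2 := [set z | z <> 0 /\ forall i, 0 <= z i 0].
Definition neg_cone : set 'cV[R]_2 := [set z | z <> 0 /\ forall i, z i 0 <= 0].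

Definition dominates y z : Prop := minkowski_sum [set y] pos_cone z.

(* The parametrizing interval is arbitrary: compactness is required of the
   curve itself and not of the parameter domain. *)
Definition continuous_compact_curve A : Prop :=
  compact A /\
  exists (I : interval R) (g : R -> 'cV[R]_2),
    {within [set` I], continuous g} /\ A = g @` [set` I].

End Plane.

Section ParetoFront.
Variables (R : realType) (n : nat).
Variables (f : 'cV[R]_n -> 'cV[R]_2) (S : set 'cV[R]_n).

Definition pareto_front : set 'cV[R]_2 :=
  [set z | (f @` S) z /\ ~ exists y, (f @` S) y /\ dominates y z].

Definition anchor_point (k : 'I_2) (z : 'cV[R]_2) : Prop :=
  pareto_front z /\ forall x, S x -> z k 0 <= f x k 0.

(* A data-set of M = m.+2 >= 2 points; the first and the last one are the
   anchor points. *)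
Definition pareto_samples (m : nat) (z : 'I_m.+2 -> 'cV[R]_2) : Prop :=
  [/\ forall j, pareto_front (z j),
      anchor_point 0 (z ord0),
      anchor_point 1 (z ord_max)
    & forall i j : 'I_m.+2, (i < j)%N -> z i 0 0 < z j 0 0].

End ParetoFront.

Section Transformation.
Variable R : realType.

Definition vec2 (a b : R) : 'cV[R]_2 := \col_i (if i == 0 then a else b).

Definition mat2 (a b c d : R) : 'M[R]_2 :=
  \matrix_(i, j) (if i == 0 then (if j == 0 then a else b)
                  else (if j == 0 then c else d)).

Variables delta1 delta2 : R.

Definition W : 'M[R]_2 :=
  (Num.sqrt 2 / 2) *: (mat2 1 (-1) 1 1 *m mat2 (1 / delta1) 0 0 (1 / delta2)).

Definition vcoord (z : 'cV[R]_2) : R := (W *m z) 0 0.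
Definition qcoord (z : 'cV[R]_2) : R := (W *m z) 1 0.

End Transformation.

Section FeasibleSet.
Variables (R : realType) (delta1 delta2 : R).
Variables (m : nat) (z : 'I_m.+2 -> 'cV[R]_2).

Local Notation zv j := (vcoord delta1 delta2 (z j)).

Definition infeasible_at (j : 'I_m.+2) : set 'cV[R]_2 :=
  (minkowski_sum [set z j] (@pos_cone R) `|`
   minkowski_sum [set z j] (@neg_cone R)) `|`
  ([set y | j = ord0 /\ y 0 0 < z j 0 0] `|`
   [set y | j = ord_max /\ y 1 0 < z j 1 0]).

Definition infeasible : set 'cV[R]_2 := \bigcup_j infeasible_at j.

Definition feasible : set 'cV[R]_2 := ~` infeasible.

Definition vrange : set R := `[zv ord0, zv ord_max].

Definition Winv_graph (h : R -> R) : set 'cV[R]_2 :=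
  [set invmx (W delta1 delta2) *m vec2 v (h v) | v in vrange].

(* Functions on the interval [vrange] are represented by total functions, whose
   values outside of [vrange] are irrelevant. *)
Definition FPFS : set (R -> R) :=
  [set h | {within vrange, continuous h} /\ Winv_graph h `<=` feasible].

(* Taken in the extended reals, so that no default value hides an empty or
   unbounded set. *)
Definition FPFS_upper (v : R) : \bar R := ereal_sup [set (h v)%:E | h in FPFS].
Definition FPFS_lower (v : R) : \bar R := ereal_inf [set (h v)%:E | h in FPFS].

(* For v in [vrange] the indices [ord0] and [ord_max] satisfy the respective
   constraints, so that these are genuine minimizers; they are unique because
   the v-coordinates of Pareto samples are strictly increasing. *)
Definition jminus (v : R) : 'I_m.+2 :=
  [arg min_(j < ord0 | (zv j <= v)%R) `|v - zv j|]%O.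
Definition jplus (v : R) : 'I_m.+2 :=
  [arg min_(j < ord_max | (v <= zv j)%R) `|v - zv j|]%O.

End FeasibleSet.

(* Main.v *)
(** In the coordinates [(v, q)] the dominance cones become the cones
    [|dv| <= |dq|], so a function is feasible iff at every [w] and for every
    sample [j] it passes through the sample or satisfies
    [|h w - q j| < |w - v j|].  The samples themselves satisfy this strict
    1-Lipschitz condition, because they do not dominate each other.  Hence the
    upper envelope [U w = min_j (q j + |w - v j|)] and the lower one
    [L w = max_j (q j - |w - v j|)] bound every feasible function, while
    [(1 - t) U + t L] is feasible for [0 < t < 1]; letting [t] tend to 0 or 1
    shows that the bounds are optimal.  By the Lipschitz condition, only the
    two neighbouring samples matter in the envelopes. *)

Require Import Defs.
From mathcomp Require Import all_boot all_order all_algebra.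
From mathcomp Require Import all_classical all_reals all_analysis.
From mathcomp Require Import ring lra.

Set Implicit Arguments.
Unset Strict Implicit.
Unset Printing Implicit Defensive.

Import Order.TTheory GRing.Theory Num.Theory.
Import numFieldNormedType.Exports.

Local Open Scope classical_set_scope.
Local Open Scope ring_scope.

(** * Envelopes of strictly 1-Lipschitz data on a finite set of nodes *)

Section Envelope.
Variables (R : realType) (I : finType) (i0 : I) (v : I -> R).
Implicit Types (q : I -> R) (w t : R).

Definition strictly_lipschitz q :=
  forall i j, i != j -> `|q i - q j| < `|v i - v j|.

(** At [w = v j] the strict bound cannot hold, so there the value of [h] is forced to be [q j]. *)
Definition interpolates_strictly_at q (h : R -> R) w :=
  forall j, (w = v j /\ h w = q j) \/ `|h w - q j| < `|w - v j|.

(** The default value of the iterated minimum is itself one of the terms, so this is the exact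
    minimum over [I]. *)
Definition upper_envelope q w : R :=
  \big[Num.min/q i0 + `|w - v i0|]_j (q j + `|w - v j|).

(** Written by negation, so that the symmetry [q -> - q] carries facts from one envelope to the
    other. *)
Definition lower_envelope q w : R := - upper_envelope (fun j => - q j) w.

Lemma strictly_lipschitzN q :
  strictly_lipschitz q -> strictly_lipschitz (fun j => - q j).
Proof. by move=> qL i j /qL; rewrite -opprD normrN. Qed.

Lemma strictly_lipschitzW q i j :
  strictly_lipschitz q -> `|q i - q j| <= `|v i - v j|.
Proof.
move=> qL; case: (eqVneq i j) => [->|/qL/ltW//]; by rewrite !subrr.
Qed.

Lemma upper_envelope_le q w j : upper_envelope q w <= q j + `|w - v j|.
Proof. exact: bigmin_le. Qed.

Lemma upper_envelope_attained q w :
  exists j, upper_envelope q w = q j + `|w - v j|.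
Proof.
rewrite /upper_envelope; elim/big_ind: _ => [|x y [i ->] [j ->]|j _].
- by exists i0.
- by rewrite /Num.min; case: ifP => _; [exists i|exists j].
- by exists j.
Qed.

Lemma lower_envelope_ge q w j : q j - `|w - v j| <= lower_envelope q w.
Proof. by rewrite lerNr opprB addrC upper_envelope_le. Qed.

Lemma lower_envelope_attained q w :
  exists j, lower_envelope q w = q j - `|w - v j|.
Proof.
have [j e] := upper_envelope_attained (fun j => - q j) w.
by exists j; rewrite /lower_envelope e opprD opprK.
Qed.

Lemma continuous_upper_envelope q : continuous (upper_envelope q).
Proof.
have cone j : continuous (fun w => q j + `|w - v j|).
  move=> w; apply: cvgD; first exact: cvg_cst.
  by apply: cvg_norm; apply: cvgB; [exact: cvg_id|exact: cvg_cst].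
rewrite /upper_envelope; elim: (index_enum I) => [|j r IHr] w.
  under eq_fun do rewrite big_nil; exact: cone.
under eq_fun do rewrite big_cons.
exact: (continuous_min (cone j w) (IHr w)).
Qed.

Lemma continuous_lower_envelope q : continuous (lower_envelope q).
Proof. by move=> w; apply: cvgN; exact: continuous_upper_envelope. Qed.

Lemma interpolates_strictly_le_upper q h w :
  interpolates_strictly_at q h w -> h w <= upper_envelope q w.
Proof.
move=> hw; have [j ->] := upper_envelope_attained q w.
by case: (hw j) => [[-> ->]|]; [rewrite subrr normr0|rewrite ltr_norml]; lra.
Qed.

Lemma interpolates_strictly_ge_lower q h w :
  interpolates_strictly_at q h w -> lower_envelope q w <= h w.
Proof.
move=> hw; have [j ->] := lower_envelope_attained q w.
by case: (hw j) => [[-> ->]|]; [rewrite subrr normr0|rewrite ltr_norml]; lra.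
Qed.

(** If the maximum is attained at [j], the gap is [2 * |w - v j| > 0]. If it is attained at another
    [i], then [q i - q j < |v i - v j| <= |w - v i| + |w - v j|]. *)
Lemma lower_envelope_lt q w j : strictly_lipschitz q -> w != v j ->
  lower_envelope q w < q j + `|w - v j|.
Proof.
move=> qL wj; have [i ->] := lower_envelope_attained q w.
have : 0 < `|w - v j| by rewrite normr_gt0 subr_eq0.
case: (eqVneq i j) => [->|/qL]; first by lra.
by have := ler_distD w (v i) (v j); rewrite (distrC (v i) w) ltr_norml; lra.
Qed.

Lemma upper_envelope_gt q w j : strictly_lipschitz q -> w != v j ->
  q j - `|w - v j| < upper_envelope q w.
Proof.
move=> /strictly_lipschitzN qL /(lower_envelope_lt qL).
rewrite /lower_envelope; under [X in upper_envelope X]eq_fun do rewrite opprK.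
by lra.
Qed.

Lemma upper_envelope_sample q j : strictly_lipschitz q ->
  upper_envelope q (v j) = q j.
Proof.
move=> qL; apply: le_anti; apply/andP; split.
  by have := upper_envelope_le q (v j) j; rewrite subrr normr0 addr0.
have [i ->] := upper_envelope_attained q (v j).
by have := strictly_lipschitzW j i qL; rewrite ler_norml; lra.
Qed.

Lemma lower_envelope_sample q j : strictly_lipschitz q ->
  lower_envelope q (v j) = q j.
Proof.
move=> /strictly_lipschitzN /upper_envelope_sample e.
by rewrite /lower_envelope e opprK.
Qed.

Definition envelope_mix q t w :=
  (1 - t) * upper_envelope q w + t * lower_envelope q w.

Lemma continuous_envelope_mix q t : continuous (envelope_mix q t).
Proof.
move=> w; apply: cvgD; apply: cvgM; try exact: cvg_cst.
- exact: continuous_upper_envelope.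
- exact: continuous_lower_envelope.
Qed.

(** Both envelopes lie in the closed band of radius [|w - v j|] around [q j]. Away from [v j] the
    lower one stays strictly below its top and the upper one strictly above its bottom, so two
    positive weights give a point of the open band. *)
Lemma envelope_mix_interpolates q t w : strictly_lipschitz q -> 0 < t < 1 ->
  interpolates_strictly_at q (envelope_mix q t) w.
Proof.
move=> qL /andP[t0 t1] j; rewrite /envelope_mix.
case: (eqVneq w (v j)) => [->|wj]; [left|right].
  by rewrite upper_envelope_sample ?lower_envelope_sample //; split=> //; ring.
have := upper_envelope_le q w j; have := lower_envelope_ge q w j.
have := lower_envelope_lt qL wj; have := upper_envelope_gt qL wj.
by rewrite ltr_norml; nra.
Qed.

Lemma envelope_mix_upper q w e : 0 < e ->
  exists2 t, 0 < t < 1 & upper_envelope q w <= envelope_mix q t w + e.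
Proof.
move=> e0; rewrite /envelope_mix.
set U := upper_envelope q w; set L := lower_envelope q w.
have d0 : 0 < `|U - L| + e + 1 by have := normr_ge0 (U - L); lra.
(* The error of the mix is [t * (U - L)]. The denominator exceeds [|U - L|], so the error is at most
   [e], and it exceeds [e], so [t < 1]; the summand [1] keeps this strict when [U = L]. *)
exists (e / (`|U - L| + e + 1)).
  by rewrite divr_gt0 //= ltr_pdivrMr //; have := normr_ge0 (U - L); lra.
set t := _ / _; have td : t * (`|U - L| + e + 1) = e by rewrite divfK ?gt_eqF.
have t0 : 0 < t by rewrite divr_gt0.
by have := ler_norm (U - L); nra.
Qed.

Lemma envelope_mix_lower q w e : 0 < e ->
  exists2 t, 0 < t < 1 & envelope_mix q t w - e <= lower_envelope q w.
Proof.
move=> e0; have [t /andP[t0 t1]] := envelope_mix_upper (fun j => - q j) w e0.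
rewrite /envelope_mix /lower_envelope.
under [X in _ + _ * - upper_envelope X _ + _]eq_fun do rewrite opprK.
(* Negating the data swaps the two envelopes, hence also the two weights. *)
by move=> le_t; exists (1 - t); lra.
Qed.

(** For a node [k] left of [w], [|w - v k| = |w - v i| + |v i - v k|], and
    [q i <= q k + |v i - v k|] by the Lipschitz condition, so the term of [k] is no smaller than
    that of [i]. On the right, [j] plays the same role. *)
Lemma upper_envelope_neighbours q w i j : strictly_lipschitz q ->
    v i <= w <= v j ->
    (forall k, v k <= w -> v k <= v i) -> (forall k, w <= v k -> v j <= v k) ->
  upper_envelope q w = Num.min (q i + `|w - v i|) (q j + `|w - v j|).
Proof.
move=> qL /andP[iw wj] imax jmin; apply: le_anti.
rewrite le_min !upper_envelope_le /=.
have [k ->] := upper_envelope_attained q w; rewrite ge_min; apply/orP.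
have [kw|/ltW wk] := leP (v k) w; [left|right].
  have := strictly_lipschitzW i k qL; have := imax k kw => ki.
  rewrite (ger0_norm (_ : 0 <= w - v i)) ?(ger0_norm (_ : 0 <= w - v k))
    ?(ger0_norm (_ : 0 <= v i - v k)) ?subr_ge0 //.
  by rewrite ler_norml; lra.
have := strictly_lipschitzW j k qL; have := jmin k wk => jk.
rewrite (ler0_norm (_ : w - v j <= 0)) ?(ler0_norm (_ : w - v k <= 0))
  ?(ler0_norm (_ : v j - v k <= 0)) ?subr_le0 //.
by rewrite ler_norml; lra.
Qed.

Lemma lower_envelope_neighbours q w i j : strictly_lipschitz q ->
    v i <= w <= v j ->
    (forall k, v k <= w -> v k <= v i) -> (forall k, w <= v k -> v j <= v k) ->
  lower_envelope q w = Num.max (q i - `|w - v i|) (q j - `|w - v j|).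
Proof.
move=> /strictly_lipschitzN qL ijw imax jmin.
rewrite /lower_envelope (upper_envelope_neighbours qL ijw) //.
by rewrite oppr_min !opprD !opprK.
Qed.

End Envelope.

(** * The coordinates [(v, q)] and the dominance cones *)

Section Coordinates.
Variables (R : realType) (d1 d2 : R).
Hypotheses (d1_gt0 : 0 < d1) (d2_gt0 : 0 < d2).
Implicit Types y z : 'cV[R]_2.

Local Notation vc := (vcoord d1 d2).
Local Notation qc := (qcoord d1 d2).
Local Notation c := (Num.sqrt 2 / 2 : R).

Lemma W_entries : W d1 d2 = mat2 (c / d1) (- (c / d2)) (c / d1) (c / d2).
Proof.
apply/matrixP => i j; rewrite !mxE !big_ord_recl big_ord0 !mxE /=.
by case: i j => [[|[|//]] ?] [[|[|//]] ?] /=; ring.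
Qed.

Lemma vcoordE y : vc y = c / d1 * y 0 0 - c / d2 * y 1 0.
Proof.
rewrite /vcoord W_entries mxE !big_ord_recl big_ord0 !mxE /= addr0 mulNr.
by congr (_ * y _ _ - _ * y _ _); apply: val_inj.
Qed.

Lemma qcoordE y : qc y = c / d1 * y 0 0 + c / d2 * y 1 0.
Proof.
rewrite /qcoord W_entries mxE !big_ord_recl big_ord0 !mxE /= addr0.
by congr (_ * y _ _ + _ * y _ _); apply: val_inj.
Qed.

Let c_gt0 : 0 < c. Proof. by rewrite divr_gt0 ?sqrtr_gt0. Qed.

Lemma W_unit : W d1 d2 \in unitmx.
Proof.
rewrite unitmxE unitfE W_entries (expand_det_row _ 0) !big_ord_recl big_ord0.
rewrite /cofactor !det_mx11 !mxE /= addr0 !add0n expr0 mul1r expr1.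
have p1 : 0 < c / d1 by rewrite divr_gt0.
have p2 : 0 < c / d2 by rewrite divr_gt0.
by rewrite gt_eqF //; nra.
Qed.

Lemma vcoord_Winv a b : vc (invmx (W d1 d2) *m vec2 a b) = a.
Proof. by rewrite /vcoord mulKVmx ?W_unit // mxE. Qed.

Lemma qcoord_Winv a b : qc (invmx (W d1 d2) *m vec2 a b) = b.
Proof. by rewrite /qcoord mulKVmx ?W_unit // mxE. Qed.

(** Up to positive factors, [q + v] is the first coordinate and [q - v] the second; this turns the
    componentwise order into the cone [|dv| <= dq]. *)
Lemma coord0_le y z : (y 0 0 <= z 0 0) = (qc y + vc y <= qc z + vc z).
Proof.
rewrite !vcoordE !qcoordE; have p1 : 0 < c / d1 by rewrite divr_gt0.
by rewrite -(ler_pM2l p1); apply/idP/idP; lra.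
Qed.

Lemma coord1_le y z : (y 1 0 <= z 1 0) = (qc y - vc y <= qc z - vc z).
Proof.
rewrite !vcoordE !qcoordE; have p2 : 0 < c / d2 by rewrite divr_gt0.
by rewrite -(ler_pM2l p2); apply/idP/idP; lra.
Qed.

Lemma forall_ord2 (P : 'I_2 -> Prop) : (forall i, P i) <-> P 0 /\ P 1.
Proof.
split=> [//|[P0 P1] [[|[|//]] ilt]].
- by rewrite (_ : Ordinal _ = 0) //; apply: val_inj.
- by rewrite (_ : Ordinal _ = 1) //; apply: val_inj.
Qed.

Lemma vq_inj y z : vc y = vc z -> qc y = qc z -> y = z.
Proof.
move=> ev eq; apply/matrixP => i j; rewrite ord1; apply: le_anti.
move: i; apply/forall_ord2.
by rewrite !coord0_le !coord1_le ev eq !lexx.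
Qed.

Lemma minkowski_sum1 (y z : 'cV[R]_2) (A : set 'cV[R]_2) :
  minkowski_sum [set y] A z <-> A (z - y).
Proof.
split=> [[_ -> [a Aa <-]]|Azy]; first by rewrite addrC addKr.
by exists y => //; exists (z - y) => //; rewrite addrC subrK.
Qed.

(* [pos_cone] and [neg_cone] coerce vectors to functions of two indices, so that
   the [0] in their definitions is the zero function. *)
Lemma fun_of_matrix_eq0 y :
  fun_of_matrix y = (0 : 'I_2 -> 'I_1 -> R) <-> y = 0.
Proof.
split=> [e|->]; first by apply/matrixP => i j; rewrite e mxE.
by apply/funext => i; apply/funext => j; rewrite mxE.
Qed.

Lemma pos_coneE y : pos_cone y <-> y <> 0 /\ 0 <= y 0 0 /\ 0 <= y 1 0.
Proof. by rewrite /pos_cone /= forall_ord2 fun_of_matrix_eq0. Qed.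

Lemma neg_coneE y : neg_cone y <-> y <> 0 /\ y 0 0 <= 0 /\ y 1 0 <= 0.
Proof. by rewrite /neg_cone /= forall_ord2 fun_of_matrix_eq0. Qed.

Lemma pos_cone_vq y z : minkowski_sum [set y] (@pos_cone R) z <->
  z <> y /\ `|vc z - vc y| <= qc z - qc y.
Proof.
rewrite minkowski_sum1 pos_coneE !mxE !subr_ge0.
rewrite coord0_le coord1_le ler_norml.
split=> -[neq h]; split.
- by move=> e; apply: neq; rewrite e subrr.
- by apply/andP; lra.
- by move/subr0_eq.
- by lra.
Qed.

Lemma neg_cone_vq y z : minkowski_sum [set y] (@neg_cone R) z <->
  z <> y /\ `|vc z - vc y| <= qc y - qc z.
Proof.
rewrite minkowski_sum1 neg_coneE !mxE !subr_le0.
rewrite coord0_le coord1_le ler_norml.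
split=> -[neq h]; split.
- by move=> e; apply: neq; rewrite e subrr.
- by apply/andP; lra.
- by move/subr0_eq.
- by lra.
Qed.

(** * Feasibility and Pareto samples in the coordinates [(v, q)] *)

Section Samples.
Variables (m : nat) (z : 'I_m.+2 -> 'cV[R]_2).

Local Notation zv := (fun j => vc (z j)).
Local Notation zq := (fun j => qc (z j)).

(* The half-planes attached to the anchor points only exclude points that are
   outside of the parameter interval or in one of the cones. *)
Lemma feasible_vq y : zv ord0 <= vc y <= zv ord_max ->
  feasible z y <-> forall j, y = z j \/ `|qc y - zq j| < `|vc y - zv j|.
Proof.
move=> /andP[v0 vM]; split=> [Fy j|Fy [j _]].
  have [|le_q] := ltP `|qc y - zq j| `|vc y - zv j|; [by right|left].
  apply: contra_notP Fy => neq; move: le_q; rewrite ler_normr => /orP le_q.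
  exists j => //; left.
  case: le_q => le_q; [left; apply/pos_cone_vq|right; apply/neg_cone_vq];
    by split=> //; lra.
case=> [[/pos_cone_vq|/neg_cone_vq] [neq le_q]|[] [ej]].
- case: (Fy j) => // lt_q.
  by have := ler_norm (qc y - qc (z j)); lra.
- case: (Fy j) => // lt_q.
  by have := ler_norm (- (qc y - qc (z j))); rewrite normrN; lra.
- rewrite ltNge coord0_le => /negP; apply; case: (Fy j) => [->//|].
  rewrite ej ltr_norml (ger0_norm (_ : 0 <= vc y - _)) ?subr_ge0 //; lra.
- rewrite ltNge coord1_le => /negP; apply; case: (Fy j) => [->//|].
  rewrite ej ltr_norml (ler0_norm (_ : vc y - _ <= 0)) ?subr_le0 //; lra.
Qed.

Lemma FPFS_vq h : FPFS d1 d2 z h <->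
  {within vrange d1 d2 z, continuous h} /\
  forall w, vrange d1 d2 z w -> interpolates_strictly_at zv zq h w.
Proof.
have range w : vrange d1 d2 z w = (zv ord0 <= w <= zv ord_max).
  by rewrite /vrange /= in_itv.
have Winv_feasible w : vrange d1 d2 z w ->
    feasible z (invmx (W d1 d2) *m vec2 w (h w)) <->
    interpolates_strictly_at zv zq h w.
  rewrite range => wr; rewrite feasible_vq ?vcoord_Winv // qcoord_Winv.
  split=> hj j; case: (hj j) => [e|]; [left|by right|left|by right].
    by rewrite -e vcoord_Winv qcoord_Winv.
  by case: e => ev eq; apply: vq_inj; rewrite ?vcoord_Winv ?qcoord_Winv.
split=> -[hc hF]; split=> //.
  by move=> w wr; apply/Winv_feasible => //; apply: hF; exists w.
by move=> _ [w wr <-]; apply/Winv_feasible => //; exact: hF.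
Qed.

(** Otherwise [|v i - v j| <= |q i - q j|], and of these two distinct points the one with the larger
    [q] lies in the positive cone of the other, hence is dominated. *)
Lemma pareto_samples_strictly_lipschitz n (f : 'cV[R]_n -> 'cV[R]_2) S :
  pareto_samples f S z -> strictly_lipschitz zv zq.
Proof.
case=> PF _ _ mono i j ij; rewrite ltNge; apply/negP.
have neq : z i <> z j.
  move=> e; move: ij; rewrite neq_ltn => /orP[] /mono; by rewrite e ltxx.
have [[fi ni] [fj nj]] := (PF i, PF j).
rewrite ler_normr => /orP[] le_q.
  by apply: ni; exists (z j); split=> //; apply/pos_cone_vq; split.
apply: nj; exists (z i); split=> //; apply/pos_cone_vq.
by split; [move=> /esym|rewrite distrC; lra].
Qed.

(** * Optimality of the envelopes and the neighbouring samples *)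

Section Bounds.
Variable w : R.
Hypothesis zL : strictly_lipschitz zv zq.
Hypothesis wr : zv ord0 <= w <= zv ord_max.

Let w_vrange : vrange d1 d2 z w. Proof. by rewrite /vrange /= in_itv. Qed.

Lemma FPFS_envelope_mix t : 0 < t < 1 ->
  FPFS d1 d2 z (envelope_mix ord0 zv zq t).
Proof.
move=> t01; apply/FPFS_vq; split=> [|u _].
  by apply: continuous_subspaceT; exact: continuous_envelope_mix.
exact: envelope_mix_interpolates.
Qed.

(** Away from the samples every feasible function stays strictly below the envelope, so the supremum
    is only approached, by mixes within any [e > 0]. *)
Lemma FPFS_upperE : FPFS_upper d1 d2 z w = (upper_envelope ord0 zv zq w)%:E.
Proof.
apply: le_anti; apply/andP; split.
  apply: ge_ereal_sup => _ [h /FPFS_vq[_ hI] <-]; rewrite lee_fin.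
  exact: interpolates_strictly_le_upper (hI w w_vrange).
apply/lee_addgt0Pr => e e0.
have [t t01 le_t] := envelope_mix_upper ord0 zv zq w e0.
apply: (@le_trans _ _ ((envelope_mix ord0 zv zq t w)%:E + e%:E)%E).
  by rewrite -EFinD lee_fin.
rewrite leeD2r //; apply: ereal_sup_ubound.
by exists (envelope_mix ord0 zv zq t) => //; exact: FPFS_envelope_mix.
Qed.

Lemma FPFS_lowerE : FPFS_lower d1 d2 z w = (lower_envelope ord0 zv zq w)%:E.
Proof.
apply: le_anti; apply/andP; split; last first.
  apply: le_ereal_inf_tmp => _ [h /FPFS_vq[_ hI] <-]; rewrite lee_fin.
  exact: interpolates_strictly_ge_lower (hI w w_vrange).
apply/lee_addgt0Pr => e e0.
have [t t01 le_t] := envelope_mix_lower ord0 zv zq w e0.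
apply: (@le_trans _ _ (envelope_mix ord0 zv zq t w)%:E).
  apply: ereal_inf_lbound.
  by exists (envelope_mix ord0 zv zq t) => //; exact: FPFS_envelope_mix.
by rewrite -EFinD lee_fin; lra.
Qed.

(** On one side of [w] the sign of [w - zv k] is fixed, so the least distance means the largest
    coordinate. *)
Lemma jminusP : let i := jminus d1 d2 z w in
  zv i <= w /\ forall k, zv k <= w -> zv k <= zv i.
Proof.
rewrite /jminus; case: arg_minP => [|i iw imin]; first by case/andP: wr.
split=> // k kw; have := imin k kw.
by rewrite !ger0_norm ?subr_ge0 //; lra.
Qed.

Lemma jplusP : let j := jplus d1 d2 z w in
  w <= zv j /\ forall k, w <= zv k -> zv j <= zv k.
Proof.
rewrite /jplus; case: arg_minP => [|i iw imin]; first by case/andP: wr.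
split=> // k kw; have := imin k kw.
by rewrite !ler0_norm ?subr_le0 //; lra.
Qed.

End Bounds.
End Samples.
End Coordinates.

Theorem theorem1 (R : realType) (n m : nat)
    (f : 'cV[R]_n -> 'cV[R]_2) (S : set 'cV[R]_n)
    (z : 'I_m.+2 -> 'cV[R]_2) (delta1 delta2 : R)
    (hdelta1 : 0 < delta1) (hdelta2 : 0 < delta2)
    (hcurve : continuous_compact_curve (pareto_front f S))
    (hz : pareto_samples f S z) :
  let zv := fun j => vcoord delta1 delta2 (z j) in
  let zq := fun j => qcoord delta1 delta2 (z j) in
  forall v : R, zv ord0 <= v <= zv ord_max ->
    let jm := jminus delta1 delta2 z v in
    let jp := jplus delta1 delta2 z v in
    FPFS_upper delta1 delta2 z v =
      (Num.min (zq jm + `|v - zv jm|) (zq jp + `|v - zv jp|))%:E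
    /\
    FPFS_lower delta1 delta2 z v =
      (Num.max (zq jm - `|v - zv jm|) (zq jp - `|v - zv jp|))%:E.
Proof.
move=> zv zq v vr jm jp.
have zL := pareto_samples_strictly_lipschitz hdelta1 hdelta2 hz.
have [jm_le jm_max] := jminusP vr; have [jp_ge jp_min] := jplusP vr.
have jv : zv jm <= v <= zv jp by apply/andP.
rewrite FPFS_upperE // FPFS_lowerE //; split.
- by rewrite (upper_envelope_neighbours ord0 zL jv).
- by rewrite (lower_envelope_neighbours ord0 zL jv).
Qed.
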